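(* Let $n\ge4$ and let $H$ be an arbitrary element of the Hilbert space $\mathscr H_n$. Then there exist points $v_1,\dots,v_n$ in a Euclidean space $\mathbb R^d$ with $d\le n-2$ such that the $\mathcal U$-centered Euclidean distance matrix of $v_1,\dots,v_n$, i.e. $\widetilde D$ for $D=(|v_i-v_j|)_{i,j}$, is exactly equal to $H$.
   Context: $\mathcal U$-centering: for a symmetric real $n\times n$ matrix $A=(a_{ij})$ with zero diagonal, $n>2$, the matrix $\widetilde A$ has entries $\widetilde A_{ii}=0$ and, for $i\neq j$, $$\widetilde A_{ij}=a_{ij}-\frac{1}{n-2}\sum_{\ell=1}^n a_{i\ell}-\frac{1}{n-2}\sum_{k=1}^n a_{kj}+\frac{1}{(n-1)(n-2)}\sum_{k,\ell=1}^n a_{k\ell}.$$ $\mathscr H_n$ is the real linear span of all matrices $\widetilde A$ where $A$ ranges over the Euclidean distance matrices $(|x_i-x_j|)_{i,j}$ of $n$-point sets in some $\mathbb R^p$, $p\ge1$ (equivalently, the set of $\widetilde A$ for $A$ in the linear span of such distance matrices), with inner product $(C\cdot D)=\frac{1}{n(n-3)}\sum_{i\ne j}C_{ij}D_{ij}$. *)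

(* Defs.v *)
(* Reals are an arbitrary real closed field R (rcfType),
   which contains the case of the real numbers. *)
From HB Require Import structures.
From mathcomp Require Import all_boot all_order all_algebra.
Set Implicit Arguments. Unset Strict Implicit. Unset Printing Implicit Defensive.
Import Order.TTheory GRing.Theory Num.Theory.
Local Open Scope ring_scope.

Definition edist (R : rcfType) (p : nat) (x y : 'rV[R]_p) : R :=
  Num.sqrt (\sum_(k < p) (x 0 k - y 0 k) ^+ 2).

Definition edm (R : rcfType) (n p : nat) (v : 'I_n -> 'rV[R]_p) : 'M[R]_n :=
  \matrix_(i, j) edist (v i) (v j).

Definition ucenter (R : rcfType) (n : nat) (A : 'M[R]_n) : 'M[R]_n :=
  \matrix_(i, j)
    if i == j then 0
    else A i j - (\sum_(l < n) A i l) / (n - 2)%:R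
               - (\sum_(k < n) A k j) / (n - 2)%:R
               + (\sum_(k < n) \sum_(l < n) A k l) / ((n - 1) * (n - 2))%:R.

(* H belongs to the space H_n: H is a finite real linear combination of
   U-centered distance matrices of n-point sets in R^p, p >= 1
   (the dimension p may vary from term to term). *)
Definition in_Hn (R : rcfType) (n : nat) (H : 'M[R]_n) : Prop :=
  exists (m : nat) (c : 'I_m -> R) (ps : 'I_m -> nat)
         (pts : forall k : 'I_m, 'I_n -> 'rV[R]_(ps k).+1),
    H = \sum_(k < m) c k *: ucenter (edm (pts k)).

(* Main.v *)
Require Import Defs.
From HB Require Import structures.
From mathcomp Require Import all_boot all_order all_algebra.
From mathcomp Require Import ring lra polyrcf.
Set Implicit Arguments. Unset Strict Implicit. Unset Printing Implicit Defensive.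
Import Order.TTheory GRing.Theory Num.Theory.
Local Open Scope ring_scope.

(* Write n = m + 2. U-centering is linear, so H = ucenter A for a symmetric,
   zero-diagonal combination A of distance matrices; moreover it annihilates
   every "additive" matrix (a_i + a_j off the diagonal). It therefore suffices
   to find eps > 0, shifts a_i and points v_i in R^m with
   |v_i - v_j| = eps A_ij + a_i + a_j for i <> j: then eps^-1 v realises H.

   We take a_i = 1/2, except a_i1 = 1/2 + s for one index i1. At eps = 0 the
   points other than i1 form a unit regular simplex, whose Gram matrix is
   positive definite, and the Gram determinant of the whole configuration is
   positive for s = 0 and negative for s = -1/2 (this is where m >= 2 is
   used). All these quantities are polynomial in eps and s, so they keep their
   signs for a small eps > 0, and the intermediate value theorem in s gives a
   singular Gram matrix with positive definite trailing block. Its Cholesky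
   factor has m columns and provides the points. *)

Section UCentering.
Variable R : rcfType.

Lemma sum_indicator n (i0 : 'I_n) (x : 'I_n -> R) :
  \sum_(l < n) (l == i0)%:R * x l = x i0.
Proof.
rewrite (bigD1 i0) //= eqxx mul1r big1 ?addr0 // => l /negbTE ->.
by rewrite mul0r.
Qed.

Lemma ucenter_lin n (a : R) (A B : 'M[R]_n) :
  ucenter (a *: A + B) = a *: ucenter A + ucenter B.
Proof.
apply/matrixP => i j; rewrite !mxE.
case: eqP => _; first by rewrite mulr0 addr0.
have entry k l : (a *: A + B) k l = a * A k l + B k l by rewrite !mxE.
have row_sum k : \sum_(l < n) (a *: A + B) k l =
    a * \sum_(l < n) A k l + \sum_(l < n) B k l.
  by rewrite mulr_sumr -big_split; apply: eq_bigr => l _; rewrite entry.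
have col_sum l : \sum_(k < n) (a *: A + B) k l =
    a * \sum_(k < n) A k l + \sum_(k < n) B k l.
  by rewrite mulr_sumr -big_split; apply: eq_bigr => k _; rewrite entry.
rewrite row_sum col_sum (eq_bigr _ (fun k _ => row_sum k)) big_split /=.
by rewrite -mulr_sumr; ring.
Qed.

Lemma ucenter0 n : ucenter (0 : 'M[R]_n) = 0.
Proof.
by have := ucenter_lin (-1) (0 : 'M[R]_n) 0; rewrite scaler0 addr0 scaleN1r addNr.
Qed.

Lemma ucenterZ n (a : R) (A : 'M[R]_n) : ucenter (a *: A) = a *: ucenter A.
Proof. by have := ucenter_lin a A 0; rewrite !addr0 ucenter0 addr0. Qed.

Lemma ucenter_sum n m (c : 'I_m -> R) (F : 'I_m -> 'M[R]_n) :
  ucenter (\sum_(k < m) c k *: F k) = \sum_(k < m) c k *: ucenter (F k).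
Proof.
elim/big_rec2: _ => [|k M N _ <-]; first exact: ucenter0.
by rewrite ucenter_lin.
Qed.

Definition additive_mx n (a : 'I_n -> R) : 'M[R]_n :=
  \matrix_(i, j) if i == j then 0 else a i + a j.

(* U-centering annihilates additive matrices, so the shifts a_i are free
   parameters when realising a U-centered matrix by distances. *)
Lemma ucenter_additive n (a : 'I_n -> R) : (2 < n)%N ->
  ucenter (additive_mx a) = 0.
Proof.
move=> n_gt2; set K := additive_mx a; set S := \sum_(l < n) a l.
have n2E : (n - 2)%:R = n%:R - 2 :> R by rewrite natrB // ltnW.
have n1E : (n - 1)%:R = n%:R - 1 :> R by rewrite natrB // ltnW // ltnW.
have K_sym i l : K i l = K l i by rewrite !mxE eq_sym addrC.
have row_sum i : \sum_(l < n) K i l = (n - 2)%:R * a i + S.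
  have Kil l : K i l = a i + a l - (l == i)%:R * (a i + a l).
    by rewrite mxE eq_sym; case: eqP; rewrite ?mul1r ?mul0r ?subrr ?subr0.
  under eq_bigr do rewrite Kil.
  rewrite sumrB sum_indicator big_split /= sumr_const card_ord -/S n2E.
  by rewrite mulrBl mulr_natl; ring.
have col_sum j : \sum_(k < n) K k j = (n - 2)%:R * a j + S.
  by rewrite -row_sum; apply: eq_bigr => k _; rewrite K_sym.
have total : \sum_(k < n) \sum_(l < n) K k l = (n - 2)%:R * S + n%:R * S.
  rewrite (eq_bigr _ (fun k _ => row_sum k)) big_split /= -mulr_sumr.
  by rewrite sumr_const card_ord [n%:R * S]mulr_natl.
apply/matrixP => i j; rewrite !mxE row_sum col_sum total.
case: eqP => // _.
have n2_neq0 : n%:R - 2 != 0 :> R.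
  by rewrite -n2E pnatr_eq0 -lt0n subn_gt0.
have n1_neq0 : n%:R - 1 != 0 :> R.
  by rewrite -n1E pnatr_eq0 -lt0n subn_gt0 ltnW.
by rewrite natrM n1E n2E; field; rewrite n2_neq0 n1_neq0.
Qed.

End UCentering.

Section EuclideanDistance.
Variable R : rcfType.

Lemma edist_sym p (x y : 'rV[R]_p) : edist x y = edist y x.
Proof.
rewrite /edist; congr Num.sqrt; apply: eq_bigr => k _.
by rewrite -opprB sqrrN.
Qed.

Lemma edist_self p (x : 'rV[R]_p) : edist x x = 0.
Proof. by rewrite /edist big1 ?sqrtr0 // => k _; rewrite subrr expr0n. Qed.

Lemma edist_scale p (c : R) (x y : 'rV[R]_p) :
  edist (c *: x) (c *: y) = `|c| * edist x y.
Proof.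
rewrite /edist (eq_bigr (fun k => c ^+ 2 * (x 0 k - y 0 k) ^+ 2)).
  by rewrite -mulr_sumr sqrtrM ?sqr_ge0 // sqrtr_sqr.
by move=> k _; rewrite !mxE -mulrBr exprMn.
Qed.

Lemma edm_scale n p (c : R) (v : 'I_n -> 'rV[R]_p) :
  edm (fun i => c *: v i) = `|c| *: edm v.
Proof. by apply/matrixP => i j; rewrite !mxE edist_scale. Qed.

Lemma sqdist_rows k p (Q : 'M[R]_(k, p)) (a b : 'I_k) :
  \sum_(c < p) (row a Q 0 c - row b Q 0 c) ^+ 2 =
  (Q *m Q^T) a a + (Q *m Q^T) b b - 2 * (Q *m Q^T) a b.
Proof.
have gram x y : (Q *m Q^T) x y = \sum_(c < p) Q x c * Q y c.
  by rewrite mxE; apply: eq_bigr => c _; rewrite mxE.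
rewrite !gram mulr_sumr -big_split -sumrB; apply: eq_bigr => c _.
by rewrite !mxE /=; ring.
Qed.

End EuclideanDistance.

Section BlockEntries.
Variables (T : Type) (k : nat).
Variables (a : 'M[T]_1) (b : 'M[T]_(1, k)) (c : 'M[T]_(k, 1)) (d : 'M[T]_k).

Let lift0E (j : 'I_k) : lift ord0 j = rshift 1 j :> 'I_(1 + k).
Proof. exact: val_inj. Qed.
Let ord0E : (ord0 : 'I_(1 + k)) = lshift k (ord0 : 'I_1).
Proof. exact: val_inj. Qed.

Lemma block_mx00 : (block_mx a b c d : 'M_(1 + k)) ord0 ord0 = a 0 0.
Proof. by rewrite ord0E block_mxEul. Qed.
Lemma block_mx0l j : (block_mx a b c d : 'M_(1 + k)) ord0 (lift ord0 j) = b 0 j.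
Proof. by rewrite lift0E ord0E block_mxEur. Qed.
Lemma block_mxl0 i : (block_mx a b c d : 'M_(1 + k)) (lift ord0 i) ord0 = c i 0.
Proof. by rewrite lift0E ord0E block_mxEdl. Qed.
Lemma block_mxll i j :
  (block_mx a b c d : 'M_(1 + k)) (lift ord0 i) (lift ord0 j) = d i j.
Proof. by rewrite !lift0E block_mxEdr. Qed.
End BlockEntries.

(* The Gram matrix of a (squared) distance matrix D on points 0..k, relative
   to the base point 0: G_ij = h (D_0i + D_0j - D_ij), where h plays the role
   of 1/2. It is stated over any commutative ring so that it can be evaluated
   on polynomial entries. *)
Definition gram_mx (T : comNzRingType) k (h : T) (D : 'M[T]_k.+1) : 'M[T]_k :=
  \matrix_(i, j) (h * (D ord0 (lift ord0 i) + D ord0 (lift ord0 j)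
                       - D (lift ord0 i) (lift ord0 j))).

Lemma map_gram_mx (T T' : comNzRingType) (f : {rmorphism T -> T'}) k (h : T)
    (D : 'M[T]_k.+1) :
  map_mx f (gram_mx h D) = gram_mx (f h) (map_mx f D).
Proof. by apply/matrixP => i j; rewrite !mxE rmorphM rmorphB rmorphD. Qed.

Lemma gram_mx_sym (T : comNzRingType) k (h : T) (D : 'M[T]_k.+1) :
  D^T = D -> (gram_mx h D)^T = gram_mx h D.
Proof.
move=> D_sym; have Dsym i j : D j i = D i j by rewrite -[in RHS]D_sym mxE.
apply/matrixP => i j; rewrite !mxE [D (lift ord0 j) _]Dsym.
by rewrite (addrC (D ord0 (lift ord0 j))).
Qed.

Section GramPoints.
Variable R : rcfType.

Definition gram_points k p (Q : 'M[R]_(k, p)) (i : 'I_k.+1) : 'rV[R]_p :=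
  row i (col_mx 0 Q : 'M_(1 + k, p)).

Lemma edist_gram_points k p (D : 'M[R]_k.+1) (Q : 'M[R]_(k, p)) :
  D^T = D -> (forall i, D i i = 0) -> gram_mx (1 / 2) D = Q *m Q^T ->
  forall i j, edist (gram_points Q i) (gram_points Q j) = Num.sqrt (D i j).
Proof.
move=> D_sym D_diag eQ.
have Dsym i j : D j i = D i j by rewrite -[in RHS]D_sym mxE.
pose Q0 : 'M_(1 + k, p) := col_mx 0 Q.
have ext_gram i j : (Q0 *m Q0^T) i j = 1 / 2 * (D ord0 i + D ord0 j - D i j).
  have -> : Q0 *m Q0^T = block_mx 0 0 0 (Q *m Q^T).
    by rewrite tr_col_mx mul_col_row trmx0 !(mul0mx, mulmx0).
  case: (unliftP ord0 i) => [i'|] ->; case: (unliftP ord0 j) => [j'|] ->.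
  - by rewrite block_mxll -eQ mxE.
  - by rewrite block_mxl0 mxE Dsym D_diag; field.
  - by rewrite block_mx0l mxE D_diag; field.
  - by rewrite block_mx00 mxE D_diag; field.
move=> i j; rewrite /edist /gram_points -/Q0 sqdist_rows !ext_gram !D_diag.
by congr Num.sqrt; field.
Qed.

End GramPoints.

Section Cholesky.
Variable R : rcfType.

(* All trailing principal minors are positive: the Sylvester-type criterion
   by which we certify positive definiteness. *)
Fixpoint pos_minors k : 'M[R]_k -> Prop :=
  match k return 'M[R]_k -> Prop with
  | 0 => fun _ => True
  | k'.+1 => fun G => 0 < \det G /\ pos_minors (drsubmx (G : 'M_(1 + k')))
  end.

Lemma sym_blockE k (G : 'M[R]_(1 + k)) : G^T = G ->
  G = block_mx (ulsubmx G) (dlsubmx G)^T (dlsubmx G) (drsubmx G).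
Proof. by move=> G_sym; rewrite trmx_dlsub G_sym submxK. Qed.

Lemma drsubmx_sym k (G : 'M[R]_(1 + k)) : G^T = G -> (drsubmx G)^T = drsubmx G.
Proof. by move=> G_sym; rewrite trmx_drsub G_sym. Qed.

Lemma unit_det_sqr_gt0 k (P : 'M[R]_k) : P \in unitmx -> 0 < \det P ^+ 2.
Proof. by rewrite unitmxE unitfE => ?; rewrite exprn_even_gt0. Qed.

Lemma schur_det k (gam : 'M[R]_1) (g : 'M[R]_(k, 1)) (P : 'M[R]_k) :
  P \in unitmx -> let x := invmx P *m g in
  \det (block_mx gam g^T g (P *m P^T)) = (gam - x^T *m x) 0 0 * \det P ^+ 2.
Proof.
move=> Pu x; have Px : P *m x = g by rewrite mulmxA mulmxV // mul1mx.
have -> : block_mx gam g^T g (P *m P^T) =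
    block_mx 1%:M x^T 0 P *m block_mx (gam - x^T *m x) 0 0 1%:M *m
    block_mx 1%:M 0 x P^T.
  rewrite !mulmx_block !(mul0mx, mulmx0, mul1mx, mulmx1, addr0, add0r).
  by rewrite subrK -trmx_mul Px.
rewrite !det_mulmx (det_ublock 1%:M) (det_ublock (_ : 'M_1)).
rewrite (det_lblock 1%:M) !det1 !det_mx11 det_tr !mul1r mulr1.
by rewrite mulrC mulrA -expr2 mulrC.
Qed.

Lemma schur_split k (gam : 'M[R]_1) (g : 'M[R]_(k, 1)) (P : 'M[R]_k)
    (x : 'M[R]_(k, 1)) : P *m x = g ->
  block_mx gam g^T g (P *m P^T) =
  block_mx (gam - x^T *m x) 0 0 0 + col_mx x^T P *m (col_mx x^T P)^T.
Proof.
move=> Px; rewrite tr_col_mx trmxK mul_col_row -trmx_mul Px add_block_mx.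
by rewrite subrK !add0r.
Qed.

Lemma cholesky k (G : 'M[R]_k) : G^T = G -> pos_minors G ->
  exists2 P : 'M_k, P \in unitmx & G = P *m P^T.
Proof.
elim: k G => [|k IH] G G_sym.
  by exists 1%:M; [rewrite unitmx1 | apply/matrixP => -[]].
case=> detG_gt0 minors; rewrite /= in minors.
have [P Pu eP] := IH _ (drsubmx_sym G_sym) minors.
set g := dlsubmx (G : 'M_(1 + k)); set gam := ulsubmx (G : 'M_(1 + k)).
have eG : G = block_mx gam g^T g (P *m P^T) :> 'M_(1 + k).
  by rewrite -eP; apply: sym_blockE.
set x := invmx P *m g; set t := (gam - x^T *m x) 0 0.
have Px : P *m x = g by rewrite mulmxA mulmxV // mul1mx.
have t_gt0 : 0 < t.
  by move: detG_gt0; rewrite eG schur_det // pmulr_lgt0 // unit_det_sqr_gt0.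
pose Q : 'M_(1 + k) := block_mx (Num.sqrt t)%:M x^T 0 P.
have eQ : Q *m Q^T = block_mx gam g^T g (P *m P^T).
  rewrite tr_block_mx mulmx_block trmx0 tr_scalar_mx trmxK.
  rewrite !(mul0mx, mulmx0, addr0, add0r) -trmx_mul Px.
  rewrite -scalar_mxM -expr2 sqr_sqrtr ?ltW //.
  by rewrite /t -mx11_scalar subrK.
exists Q; last by rewrite eQ -eG.
rewrite unitmxE (det_ublock ((Num.sqrt t)%:M : 'M_1)) det_scalar1 unitfE.
rewrite mulf_neq0 //; first by rewrite gt_eqF ?sqrtr_gt0.
by rewrite -unitfE -unitmxE.
Qed.

Lemma cholesky_singular k (G : 'M[R]_(1 + k)) : G^T = G ->
  pos_minors (drsubmx G) -> \det G = 0 -> exists Q : 'M[R]_(1 + k, k), G = Q *m Q^T.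
Proof.
move=> G_sym minors detG0.
have [P Pu eP] := cholesky (drsubmx_sym G_sym) minors.
set g := dlsubmx G; set gam := ulsubmx G.
have eG : G = block_mx gam g^T g (P *m P^T) by rewrite -eP; apply: sym_blockE.
set x := invmx P *m g.
have Px : P *m x = g by rewrite mulmxA mulmxV // mul1mx.
have t0 : gam - x^T *m x = 0.
  move: detG0; rewrite eG schur_det // => /eqP.
  rewrite mulf_eq0 (gt_eqF (unit_det_sqr_gt0 Pu)) orbF => /eqP t0.
  by rewrite [LHS]mx11_scalar t0 raddf0.
by exists (col_mx x^T P); rewrite eG (schur_split _ Px) t0 block_mx0 add0r.
Qed.

End Cholesky.

Section NearZero.
Variable R : rcfType.

Definition near_zero (P : R -> Prop) : Prop :=
  exists2 d : R, 0 < d & forall e, `|e| < d -> P e.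

Lemma near_zero_and (P Q : R -> Prop) :
  near_zero P -> near_zero Q -> near_zero (fun e => P e /\ Q e).
Proof.
move=> [d1 d1_gt0 P1] [d2 d2_gt0 Q2]; exists (Num.min d1 d2).
  by rewrite lt_min d1_gt0 d2_gt0.
by move=> e; rewrite lt_min => /andP[/P1 ? /Q2 ?].
Qed.

Lemma near_zero_impl (P Q : R -> Prop) :
  (forall e, P e -> Q e) -> near_zero P -> near_zero Q.
Proof. by move=> PQ [d d_gt0 Pd]; exists d => // e /Pd /PQ. Qed.

Lemma near_zero_all k (P : 'I_k -> R -> Prop) :
  (forall i, near_zero (P i)) -> near_zero (fun e => forall i, P i e).
Proof.
elim: k P => [|k IH] P P_near; first by exists 1 => // e _ [].
have := near_zero_and (P_near ord0) (IH (fun j => P (lift ord0 j)) (fun j => P_near _)).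
apply: near_zero_impl => e [P0 Plift] i.
by case: (unliftP ord0 i) => [j ->|->].
Qed.

Lemma near_zero_poly_gt0 (p : {poly R}) : 0 < p.[0] -> near_zero (fun e => 0 < p.[e]).
Proof.
move=> p0_gt0; have [d d_gt0 p_cont] := poly_cont 0 p p0_gt0.
exists d => // e e_small; move: (p_cont e); rewrite subr0 => /(_ e_small).
by rewrite ltr_distl subrr => /andP[].
Qed.

Lemma near_zero_poly_lt0 (p : {poly R}) : p.[0] < 0 -> near_zero (fun e => p.[e] < 0).
Proof.
move=> p0_lt0; have := @near_zero_poly_gt0 (- p).
rewrite hornerN oppr_gt0 => /(_ p0_lt0).
by apply: near_zero_impl => e; rewrite hornerN oppr_gt0.
Qed.

Lemma near_zero_pos_minors k (M : 'M[{poly R}]_k) :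
  pos_minors (map_mx (horner_eval 0) M) ->
  near_zero (fun e => pos_minors (map_mx (horner_eval e) M)).
Proof.
elim: k M => [|k IH] M /=; first by exists 1.
rewrite det_map_mx => -[det0_gt0 minors0].
have near_det := near_zero_poly_gt0 det0_gt0.
have near_minors := IH (drsubmx (M : 'M_(1 + k))) ltac:(by rewrite map_drsubmx).
apply: near_zero_impl (near_zero_and near_det near_minors) => e [det_gt0 minors].
by rewrite det_map_mx -map_drsubmx.
Qed.

End NearZero.

Section RegularSimplex.
Variable R : rcfType.

(* Gram matrix of a regular simplex with unit edges, relative to a vertex:
   1 on the diagonal and 1/2 elsewhere. *)
Definition simplex_gram k : 'M[R]_k := \matrix_(i, j) if i == j then 1 else 1 / 2.

Lemma simplex_gram_col_sum k (j : 'I_k) :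
  \sum_(l < k) (if l == j then 1 else 1 / 2 : R) = (k%:R + 1) / 2.
Proof.
have E l : (if l == j then 1 else 1 / 2 : R) = 1 / 2 + (l == j)%:R * (1 / 2).
  by case: eqP => _; rewrite ?mul1r ?mul0r ?addr0 //; field.
rewrite (eq_bigr _ (fun l _ => E l)) big_split /= sum_indicator sumr_const card_ord.
by rewrite -mulr_natl; field.
Qed.

Lemma det_bordered_simplex k (gam : R) :
  \det (block_mx gam%:M (const_mx (1 / 2)) (const_mx (1 / 2)) (simplex_gram k)
        : 'M_(1 + k)) = (gam - k%:R / (2 * (k%:R + 1))) * \det (simplex_gram k).
Proof.
pose b : R := 1 / (k%:R + 1).
have k1_neq0 : k%:R + 1 != 0 :> R by rewrite lt0r_neq0 // ltr_wpDl.
have -> : block_mx gam%:M (const_mx (1 / 2)) (const_mx (1 / 2)) (simplex_gram k) =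
    block_mx (1%:M : 'M_1) (const_mx b) 0 1%:M *m
    block_mx (gam - k%:R / (2 * (k%:R + 1)))%:M 0 (const_mx (1 / 2)) (simplex_gram k).
  rewrite mulmx_block !(mul0mx, mulmx0, mul1mx, addr0, add0r); congr block_mx.
    apply/matrixP => i j; rewrite !mxE; under eq_bigr do rewrite !mxE.
    rewrite sumr_const card_ord !(ord1 i) !(ord1 j) /= mulr1n.
    by rewrite /b -mulr_natr; field.
  apply/matrixP => i j; rewrite !mxE; under eq_bigr do rewrite !mxE.
  by rewrite -mulr_sumr simplex_gram_col_sum /b; field.
rewrite det_mulmx (det_ublock (1%:M : 'M_1)) (det_lblock (_%:M : 'M_1)).
by rewrite !det1 det_scalar1 !mul1r.
Qed.

Lemma simplex_gram_block k :
  (simplex_gram (1 + k) : 'M_(1 + k)) =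
  block_mx 1%:M (const_mx (1 / 2)) (const_mx (1 / 2)) (simplex_gram k).
Proof.
apply/matrixP => i j.
case: (unliftP ord0 i) => [i'|] ->; case: (unliftP ord0 j) => [j'|] ->.
- by rewrite block_mxll !mxE (inj_eq (@lift_inj _ ord0)).
- by rewrite block_mxl0 !mxE lift_eqF.
- by rewrite block_mx0l !mxE eq_liftF.
- by rewrite block_mx00 !mxE eqxx.
Qed.

Lemma simplex_gram_pos k : 0 < \det (simplex_gram k) /\ pos_minors (simplex_gram k).
Proof.
elim: k => [|k [det_gt0 minors]]; first by rewrite det_mx00.
have det_gt0' : 0 < \det (simplex_gram k.+1).
  rewrite [simplex_gram k.+1]simplex_gram_block det_bordered_simplex pmulr_lgt0 //.
  rewrite subr_gt0 ltr_pdivrMr ?mul1r; last by rewrite mulr_gt0 // ltr_wpDl.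
  by have := ler0n R k; lra.
by do !split => //; rewrite [simplex_gram k.+1 : 'M_(1 + k)]simplex_gram_block block_mxKdr.
Qed.

End RegularSimplex.

(* Again over any commutative ring, to allow
   polynomial parameters e and s. *)
Section Configuration.
Variables (T : comNzRingType) (m : nat).

Definition i1 : 'I_m.+2 := lift ord0 ord0.

Definition shift (h s : T) (i : 'I_m.+2) : T := h + (if i == i1 then s else 0).

Definition config_sqdist (h : T) (A : 'M[T]_m.+2) (e s : T) : 'M[T]_m.+2 :=
  \matrix_(i, j) (if i == j then 0 else (e * A i j + shift h s i + shift h s j) ^+ 2).

Definition config_gram (h : T) (A : 'M[T]_m.+2) (e s : T) : 'M[T]_m.+1 :=
  gram_mx h (config_sqdist h A e s).

Lemma shift_ord0 h s : shift h s ord0 = h.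
Proof. by rewrite /shift /i1 eq_liftF addr0. Qed.

Lemma shift_i1 h s : shift h s i1 = h + s.
Proof. by rewrite /shift eqxx. Qed.

Lemma shift_lift2 h s k : shift h s (lift ord0 (lift ord0 k)) = h.
Proof.
by rewrite /shift /i1 (inj_eq (@lift_inj _ ord0)) lift_eqF addr0.
Qed.

(* The parameter s only moves the point i1, which is not seen by the
   trailing block of the Gram matrix. *)
Lemma drsubmx_config_gram h A e s :
  drsubmx (config_gram h A e s : 'M_(1 + m)) = drsubmx (config_gram h A e 0 : 'M_(1 + m)).
Proof.
apply/matrixP => k l; rewrite !mxE.
have liftE (j : 'I_m) : rshift 1 j = lift ord0 j by apply: val_inj.
by rewrite !liftE !shift_ord0 !shift_lift2.
Qed.

End Configuration.

Lemma map_config_gram (T T' : comNzRingType) (f : {rmorphism T -> T'}) m h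
    (A : 'M[T]_m.+2) e s :
  map_mx f (config_gram h A e s) = config_gram (f h) (map_mx f A) (f e) (f s).
Proof.
rewrite map_gram_mx; congr gram_mx; apply/matrixP => i j; rewrite !mxE.
case: eqP => _; first exact: rmorph0.
by rewrite rmorphXn !rmorphD rmorphM /shift !fun_if rmorph0.
Qed.

Section RealConfiguration.
Variables (R : rcfType) (m : nat) (A : 'M[R]_m.+2).

Lemma config_sqdist_sym e s : A^T = A ->
  (config_sqdist (1 / 2) A e s)^T = config_sqdist (1 / 2) A e s.
Proof.
move=> A_sym; have Asym i j : A j i = A i j by rewrite -[in RHS]A_sym mxE.
by apply/matrixP => i j; rewrite !mxE eq_sym Asym (addrAC _ (shift _ _ j)) addrA.
Qed.

Lemma config_sqdist_diag e s i : config_sqdist (1 / 2) A e s i i = 0.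
Proof. by rewrite mxE eqxx. Qed.

(* At e = 0 all points but i1 form a unit regular simplex, and i1 is at
   distance 1 + s from all of them. *)
Lemma config_gram_at0 s :
  (config_gram (1 / 2) A 0 s : 'M_(1 + m)) =
  block_mx ((1 + s) ^+ 2)%:M (const_mx (1 / 2)) (const_mx (1 / 2)) (simplex_gram R m).
Proof.
have D0 i j : config_sqdist (1 / 2) A 0 s i j =
    if i == j then 0 else (shift (1 / 2) s i + shift (1 / 2) s j) ^+ 2.
  by rewrite mxE mul0r add0r.
apply/matrixP => i j; rewrite [in LHS]mxE !D0.
case: (unliftP ord0 i) => [i'|] ->; case: (unliftP ord0 j) => [j'|] ->;
  rewrite ?(inj_eq (@lift_inj _ ord0)) ?eq_liftF ?lift_eqF ?eqxx;
  rewrite ?shift_ord0 ?shift_lift2 ?shift_i1.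
- by rewrite block_mxll !mxE; case: eqP => _; field.
- by rewrite block_mxl0 !mxE; field.
- by rewrite block_mx0l !mxE; field.
- by rewrite block_mx00 !mxE eqxx mulr1n; field.
Qed.

End RealConfiguration.

Lemma eval_config_gram (R : rcfType) m (A : 'M[R]_m.+2) (E S : {poly R}) x :
  map_mx (horner_eval x) (config_gram (1 / 2)%:P (map_mx polyC A) E S) =
  config_gram (1 / 2) A E.[x] S.[x].
Proof.
rewrite map_config_gram /= horner_evalE hornerC; congr config_gram.
by apply/matrixP => i j; rewrite !mxE horner_evalE hornerC.
Qed.

Section Perturbation.
Variables (R : rcfType) (m : nat) (A : 'M[R]_m.+2).
Hypothesis m_ge2 : (2 <= m)%N.

Local Notation G e s := (config_gram (1 / 2) A e s : 'M_(1 + m)).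

Lemma det_config_gram_eval (E S : {poly R}) x :
  (\det (config_gram (1 / 2)%:P (map_mx polyC A) E S)).[x] = \det (G E.[x] S.[x]).
Proof. by rewrite -horner_evalE -det_map_mx eval_config_gram. Qed.

(* At e = 0 the Gram determinant is positive for s = 0 and negative for
   s = -1/2; the latter needs m >= 2. *)
Lemma det_config_gram_at0_signs :
  0 < \det (G 0 0) /\ \det (G 0 (- (1 / 2))) < 0.
Proof.
have [det_simplex_gt0 _] := simplex_gram_pos R m.
have m_ge2R : 2 <= m%:R :> R by rewrite (ler_nat R 2 m).
have denom_gt0 : 0 < 2 * (m%:R + 1) :> R.
  by rewrite mulr_gt0 // ltr_wpDl // (le_trans _ m_ge2R).
rewrite !config_gram_at0 !det_bordered_simplex pmulr_lgt0 // pmulr_llt0 //.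
rewrite addr0 expr1n subr_gt0 subr_lt0 ltr_pdivrMr // ltr_pdivlMr //.
split; first by lra.
have -> : (1 + - (1 / 2)) ^+ 2 = 1 / 4 :> R by field.
by rewrite mulrC mulrA ltr_pdivrMr //; lra.
Qed.

Lemma small_perturbation : exists2 eps : R, 0 < eps &
  [/\ pos_minors (drsubmx (G eps 0)), 0 < \det (G eps 0),
      \det (G eps (- (1 / 2))) < 0 & forall i j, 0 < 1 / 2 + eps * A i j].
Proof.
pose GP (E S : {poly R}) : 'M_(1 + m) := config_gram (1 / 2)%:P (map_mx polyC A) E S.
have [_ simplex_minors] := simplex_gram_pos R m.
have [det_pos0 det_neg0] := det_config_gram_at0_signs.
have near_minors : near_zero (fun e => pos_minors (drsubmx (G e 0))).
  have := @near_zero_pos_minors R _ (drsubmx (GP 'X 0)).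
  rewrite map_drsubmx eval_config_gram hornerX horner0 config_gram_at0 block_mxKdr.
  move=> /(_ simplex_minors); apply: near_zero_impl => e.
  by rewrite map_drsubmx eval_config_gram hornerX horner0.
have near_det_pos : near_zero (fun e => 0 < \det (G e 0)).
  have := @near_zero_poly_gt0 R (\det (GP 'X 0)).
  rewrite det_config_gram_eval hornerX horner0 => /(_ det_pos0).
  by apply: near_zero_impl => e; rewrite det_config_gram_eval hornerX horner0.
have near_det_neg : near_zero (fun e => \det (G e (- (1 / 2))) < 0).
  have := @near_zero_poly_lt0 R (\det (GP 'X (- (1 / 2))%:P)).
  rewrite det_config_gram_eval hornerX hornerC => /(_ det_neg0).
  by apply: near_zero_impl => e; rewrite det_config_gram_eval hornerX hornerC.
have near_pos : near_zero (fun e => forall i j, 0 < 1 / 2 + e * A i j).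
  apply: near_zero_all => i; apply: near_zero_all => j.
  have := @near_zero_poly_gt0 R ((1 / 2)%:P + 'X * (A i j)%:P).
  rewrite hornerD hornerM hornerX !hornerC mul0r addr0 => /(_ ltac:(lra)).
  by apply: near_zero_impl => e; rewrite hornerD hornerM hornerX !hornerC.
have [d d_gt0 near] := near_zero_and near_minors
  (near_zero_and near_det_pos (near_zero_and near_det_neg near_pos)).
have half_d_gt0 : 0 < d / 2 by rewrite divr_gt0.
exists (d / 2) => //.
have [? [? [? ?]]] := near (d / 2) ltac:(by rewrite gtr0_norm // ltr_pdivrMr //; lra).
by split.
Qed.

(* Choosing s by the intermediate value theorem makes the Gram matrix
   singular, so the configuration embeds in dimension m: the perturbed
   distances eps A_ij + shift_i + shift_j are Euclidean in R^m. *)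
Lemma perturbed_embedding : A^T = A -> (forall i, A i i = 0) ->
  exists2 eps : R, 0 < eps & exists s (v : 'I_m.+2 -> 'rV[R]_m),
    edm v = eps *: A + additive_mx (shift (1 / 2) s).
Proof.
move=> A_sym A_diag.
have [eps eps_gt0 [minors det_pos det_neg dist_pos]] := small_perturbation.
pose p := \det (config_gram (1 / 2)%:P (map_mx polyC A) eps%:P 'X).
have pE x : p.[x] = \det (G eps x) by rewrite det_config_gram_eval hornerC hornerX.
have [s s_in root_s] : {s | s \in `[- (1 / 2), 0] & root p s}.
  by apply: polyrcf.poly_ivt; rewrite ?pE; nra.
move: s_in; rewrite in_itv /= => /andP[s_ge s_le].
have det0 : \det (G eps s) = 0 by rewrite -pE; apply/rootP.
have minors_s : pos_minors (drsubmx (G eps s)) by rewrite drsubmx_config_gram.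
pose D := config_sqdist (1 / 2) A eps s.
have D_sym : D^T = D := config_sqdist_sym eps s A_sym.
have [Q eQ] := cholesky_singular (gram_mx_sym (1 / 2) D_sym) minors_s det0.
exists eps => //; exists s, (gram_points Q).
apply/matrixP => i j.
rewrite !mxE (edist_gram_points D_sym (config_sqdist_diag A eps s) eQ) mxE.
case: eqP => [->|i_neq_j]; first by rewrite sqrtr0 A_diag mulr0 add0r.
rewrite sqrtr_sqr ger0_norm -?addrA // /shift.
have := dist_pos i j; case: eqP => [ei|_]; case: eqP => [ej|_]; try lra.
by rewrite ei ej in i_neq_j.
Qed.

Lemma ucenter_realisable : A^T = A -> (forall i, A i i = 0) ->
  exists v : 'I_m.+2 -> 'rV[R]_m, ucenter (edm v) = ucenter A.
Proof.
move=> A_sym A_diag.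
have [eps eps_gt0 [s [v ev]]] := perturbed_embedding A_sym A_diag.
exists (fun i => eps^-1 *: v i).
rewrite edm_scale ger0_norm ?invr_ge0 ?ltW // ucenterZ ev ucenter_lin.
rewrite ucenter_additive; last by rewrite !ltnS (ltnW m_ge2).
by rewrite addr0 scalerA mulVf ?gt_eqF // scale1r.
Qed.

End Perturbation.

Lemma edm_combination_sym_diag (R : rcfType) n m (c : 'I_m -> R) (ps : 'I_m -> nat)
    (pts : forall k : 'I_m, 'I_n -> 'rV[R]_(ps k).+1) :
  let A := \sum_(k < m) c k *: edm (pts k) in A^T = A /\ forall i, A i i = 0.
Proof.
split; last by move=> i; rewrite summxE big1 // => k _; rewrite !mxE edist_self mulr0.
apply/matrixP => i j; rewrite !mxE !summxE; apply: eq_bigr => k _.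
by rewrite !mxE edist_sym.
Qed.

Theorem theorem2 (R : rcfType) (n : nat) (hn : (4 <= n)%N)
  (H : 'M[R]_n) (hH : in_Hn H) :
  exists (d : nat), (d <= n - 2)%N /\
    exists v : 'I_n -> 'rV[R]_d, ucenter (edm v) = H.
Proof.
case: hH => m [c [ps [pts ->]]]; clear H.
have [A_sym A_diag] := edm_combination_sym_diag c pts.
rewrite -ucenter_sum; case: n hn pts A_sym A_diag => [|[|d]] // hd pts A_sym A_diag.
exists d; split; first by rewrite !subSS subn0.
exact: ucenter_realisable.
Qed.
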